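(* Given a sequence of polynomials $(a_{0,n}(x))_{n\ge 0}$, define $a_{k,n}(x)=a_{k-1,n}(x)+a_{k-1,n+1}(x)$ for $k\ge 1$, $n\ge 0$. Then the following hold, the generating function identities being of formal power series in $t$. (1) If $a_{0,n}(x)=K_n(x)$ for all $n\ge 0$, then $a_{n,0}(x)=\sum_{l=0}^{n}\binom{n}{l}K_l(x)$ for all $n\ge 0$ and $\sum_{n=0}^{\infty}a_{n,0}(x)\frac{t^n}{n!}=e^t\frac{1}{(1-t)^2}e^{\frac{xt}{(1-t)^2}}$. (2) If $a_{0,n}(x)=J_n(x)$ for all $n\ge 0$, then $a_{n,0}(x)=\sum_{k=0}^{n}\binom{n}{k}J_k(x)$ for all $n\ge 0$ and $\sum_{n=0}^{\infty}a_{n,0}(x)\frac{t^n}{n!}=e^t\frac{1}{1-t}e^{\frac{xt}{(1-t)^2}}$. (3) If $a_{0,n}(x)=L_n(x)$ for all $n\ge 0$, then $a_{n,0}(x)=\sum_{k=0}^{n}\binom{n}{k}L_k(x)$ for all $n\ge 0$ and $\sum_{n=0}^{\infty}a_{n,0}(x)\frac{t^n}{n!}=e^t e^{\frac{xt}{(1-t)^2}}$.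
   Context: $x$ is an indeterminate over the real numbers. The array $(a_{k,n}(x))_{k,n\ge 0}$ is the Euler-Seidel matrix with initial sequence $(a_{0,n}(x))_{n\ge 0}$. For $n\ge 0$, $K_n(x)=n!\sum_{k=0}^{n}\binom{n+k+1}{n-k}\frac{x^k}{k!}$. The polynomials $J_n(x)$ are defined by $J_0(x)=1$ and $J_n(x)=K_n(x)-nK_{n-1}(x)$ for $n\ge 1$. The polynomials $L_n(x)$ are defined by $L_n(x)=J_n(x)-nJ_{n-1}(x)$ for $n\ge 0$, where for $n=0$ the second term is read as $0$, so $L_0(x)=1$. *)

(* Defs.v *)
From HB Require Import structures.
From mathcomp Require Import all_boot all_order all_algebra.
From mathcomp Require Import boolp reals.

Set Implicit Arguments.
Unset Strict Implicit.
Unset Printing Implicit Defensive.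

Import GRing.Theory.

Local Open Scope ring_scope.

(* The ring A[[t]] of formal power series; [fps_coef f n] is the coefficient
   of t^n.  The record wrapper keeps the Cauchy product apart from the pointwise
   product on functions. *)
Record fps (A : Type) := Fps { fps_coef : nat -> A }.

HB.instance Definition _ (A : Type) := gen_eqMixin (fps A).
HB.instance Definition _ (A : Type) := gen_choiceMixin (fps A).

Lemma fpsP (A : Type) (f g : fps A) : fps_coef f =1 fps_coef g <-> f = g.
Proof.
split=> [|-> //]; case: f g => [f] [g] /= fg.
by congr Fps; apply/funext.
Qed.

Definition fps_zero (A : zmodType) : fps A := Fps (fun=> 0).
Definition fps_opp (A : zmodType) (f : fps A) : fps A :=
  Fps (fun n => - fps_coef f n).
Definition fps_add (A : zmodType) (f g : fps A) : fps A :=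
  Fps (fun n => fps_coef f n + fps_coef g n).

Fact fps_addA (A : zmodType) : associative (@fps_add A).
Proof. by move=> f g h; apply/fpsP => n /=; rewrite addrA. Qed.
Fact fps_addC (A : zmodType) : commutative (@fps_add A).
Proof. by move=> f g; apply/fpsP => n /=; rewrite addrC. Qed.
Fact fps_add0 (A : zmodType) : left_id (@fps_zero A) (@fps_add A).
Proof. by move=> f; apply/fpsP => n /=; rewrite add0r. Qed.
Fact fps_addN (A : zmodType) :
  left_inverse (@fps_zero A) (@fps_opp A) (@fps_add A).
Proof. by move=> f; apply/fpsP => n /=; rewrite addNr. Qed.

HB.instance Definition _ (A : zmodType) :=
  GRing.isZmodule.Build (fps A) (@fps_addA A) (@fps_addC A) (@fps_add0 A)
    (@fps_addN A).

Definition fpsC (A : nzRingType) (c : A) : fps A :=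
  Fps (fun n => if n == 0%N then c else 0).
Definition fpsX (A : nzRingType) : fps A := Fps (fun n => (n == 1%N)%:R).
Definition fps_mul (A : nzRingType) (f g : fps A) : fps A :=
  Fps (fun n => \sum_(i < n.+1) fps_coef f i * fps_coef g (n - i)).

Definition fps_trunc (A : nzRingType) (N : nat) (f : fps A) : {poly A} :=
  \poly_(i < N) fps_coef f i.

Lemma coef_fps_trunc (A : nzRingType) (N n : nat) (f : fps A) :
  (n < N)%N -> (fps_trunc N f)`_n = fps_coef f n.
Proof. by move=> nN; rewrite coef_poly nN. Qed.

Lemma coef_fps_trunc_mul (A : nzRingType) (N n : nat) (f g : fps A) :
  (n < N)%N ->
  (fps_trunc N f * fps_trunc N g)`_n = fps_coef (fps_mul f g) n.
Proof.
move=> nN; rewrite coefM /=; apply: eq_bigr => i _.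
rewrite !coef_fps_trunc //; first exact: leq_ltn_trans (leq_subr _ _) nN.
by apply: leq_ltn_trans nN; rewrite -ltnS.
Qed.

Fact fps_mulC (A : comNzRingType) : commutative (@fps_mul A).
Proof.
move=> f g; apply/fpsP => n.
by rewrite -!(coef_fps_trunc_mul _ _ (ltnSn n)) mulrC.
Qed.

Fact fps_mulA (A : comNzRingType) : associative (@fps_mul A).
Proof.
move=> f g h; apply/fpsP => n.
transitivity ((fps_trunc n.+1 f * (fps_trunc n.+1 g * fps_trunc n.+1 h))`_n).
  rewrite coefM /=; apply: eq_bigr => i _.
  rewrite coef_fps_trunc ?ltn_ord // coef_fps_trunc_mul //.
  by rewrite ltnS leq_subr.
rewrite mulrA coefM /=; apply: eq_bigr => i _.
by rewrite coef_fps_trunc_mul ?ltn_ord // coef_fps_trunc // ltnS leq_subr.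
Qed.

Fact fps_mul1 (A : nzRingType) : left_id (fpsC (1 : A)) (@fps_mul A).
Proof.
move=> f; apply/fpsP => n /=.
rewrite big_ord_recl /= subn0 mul1r big1 ?addr0 // => i _.
by rewrite mul0r.
Qed.

Fact fps_mulDl (A : nzRingType) :
  left_distributive (@fps_mul A) (@fps_add A).
Proof.
move=> f g h; apply/fpsP => n /=; rewrite -big_split /=.
by apply: eq_bigr => i _; rewrite mulrDl.
Qed.

Fact fps_oner_neq0 (A : nzRingType) : fpsC (1 : A) != @fps_zero A.
Proof.
apply/eqP => /fpsP /(_ 0%N) /= /eqP.
by rewrite (negPf (oner_neq0 A)).
Qed.

HB.instance Definition _ (A : comNzRingType) :=
  GRing.Zmodule_isComNzRing.Build (fps A) (@fps_mulA A) (@fps_mulC A)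
    (@fps_mul1 A) (@fps_mulDl A) (@fps_oner_neq0 A).

(* A series is invertible iff its constant coefficient is; the first n
   coefficients g_i of its inverse are given by
   f_0 g_n = [n = 0] - \sum_(i < n) f_(n-i) g_i. *)
Definition fps_unit (A : comUnitRingType) : {pred fps A} :=
  fun f => fps_coef f 0%N \is a GRing.unit.

Fixpoint fps_inv_seq (A : comUnitRingType) (f : fps A) (n : nat) : seq A :=
  if n is m.+1 then
    let s := fps_inv_seq f m in
    rcons s ((fps_coef f 0%N)^-1 *
             ((m == 0%N)%:R - \sum_(i < m) fps_coef f (m - i) * s`_i))
  else [::].

Definition fps_inv (A : comUnitRingType) (f : fps A) : fps A :=
  if f \in @fps_unit A then Fps (fun n => (fps_inv_seq f n.+1)`_n) else f.

Lemma size_fps_inv_seq (A : comUnitRingType) (f : fps A) (n : nat) :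
  size (fps_inv_seq f n) = n.
Proof. by elim: n => //= n IHn; rewrite size_rcons IHn. Qed.

Lemma nth_fps_inv_seq (A : comUnitRingType) (f : fps A) (n i : nat) :
  (i < n)%N -> (fps_inv_seq f n)`_i = (fps_inv_seq f i.+1)`_i.
Proof.
elim: n => // n IHn; rewrite ltnS leq_eqVlt => /predU1P[-> // | lt_in].
by rewrite -IHn //= nth_rcons size_fps_inv_seq lt_in.
Qed.

Fact fps_mulV (A : comUnitRingType) :
  {in @fps_unit A, left_inverse 1 (@fps_inv A) *%R}.
Proof.
move=> f fU; rewrite mulrC; apply/fpsP => n.
rewrite /fps_inv fU /GRing.mul /= big_ord_recl /= subn0.
rewrite nth_rcons size_fps_inv_seq ltnn eqxx mulVKr; last exact: fU.
suff -> : \sum_(i < n) fps_coef f (bump 0 i) *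
            (fps_inv_seq f (n - bump 0 i).+1)`_(n - bump 0 i) =
          \sum_(i < n) fps_coef f (n - i) * (fps_inv_seq f n)`_i.
  by rewrite subrK; case: n.
rewrite (reindex_inj rev_ord_inj) /=; apply: eq_bigr => i _.
have -> : bump 0 (n - i.+1) = (n - i)%N by rewrite /bump /= add1n subnSK.
by rewrite subKn 1?ltnW // nth_fps_inv_seq.
Qed.

Fact fps_unitPl (A : comUnitRingType) (f g : fps A) :
  g * f = 1 -> fps_unit f.
Proof.
move=> /fpsP /(_ 0%N); rewrite /GRing.mul /= big_ord1 subnn => gf1.
by apply/unitrP; exists (fps_coef g 0); split; rewrite // mulrC.
Qed.

Fact fps_inv_out (A : comUnitRingType) :
  {in [predC @fps_unit A], @fps_inv A =1 id}.
Proof. by move=> f /negPf fU; rewrite /fps_inv fU. Qed.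

HB.instance Definition _ (A : comUnitRingType) :=
  GRing.ComNzRing_hasMulInverse.Build (fps A) (@fps_mulV A) (@fps_unitPl A)
    (@fps_inv_out A).

(* The exponential \sum_k f^k / k! of a series with zero constant coefficient.
   The coefficient of t^n only involves the terms with k <= n, since f^k then
   has order at least k (see [fps_coef_exp_lt]).  As in [fps_egf], the factorials
   are meant to be invertible in A. *)
Definition fps_exp (A : comUnitRingType) (f : fps A) : fps A :=
  Fps (fun n => \sum_(k < n.+1) fps_coef (f ^+ k) n / (k`!)%:R).

Lemma fps_coef_exp_lt (A : comUnitRingType) (f : fps A) (k n : nat) :
  fps_coef f 0%N = 0 -> (n < k)%N -> fps_coef (f ^+ k) n = 0.
Proof.
move=> f0; elim: k n => // k IHk n lt_nk.
rewrite exprS /GRing.mul /= big1 // => -[[|i] /= lt_in] _.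
  by rewrite f0 mul0r.
rewrite IHk ?mulr0 //; apply: leq_trans (_ : n <= k)%N => //.
by rewrite ltn_subrL /=; apply: leq_ltn_trans (leq0n i) _; rewrite -ltnS.
Qed.

(* The exponential generating function \sum_n u_n t^n / n!. *)
Definition fps_egf (A : comUnitRingType) (u : nat -> A) : fps A :=
  Fps (fun n => u n / (n`!)%:R).

(* The Euler-Seidel matrix a_{k,n} with initial sequence a_{0,n} = a n. *)
Fixpoint euler_seidel (V : zmodType) (a : nat -> V) (k n : nat) : V :=
  if k is j.+1 then euler_seidel a j n + euler_seidel a j n.+1 else a n.

(* In K_n, J_n and L_n the indeterminate x is 'X : {poly R}. *)
Definition K_poly (R : realType) (n : nat) : {poly R} :=
  (n`!)%:R *:
    \sum_(k < n.+1) 'C(n + k + 1, n - k)%:R *: ((k`!)%:R^-1 *: 'X^k).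

Definition J_poly (R : realType) (n : nat) : {poly R} :=
  if n is m.+1 then K_poly R n - n%:R *: K_poly R m else 1.

Definition L_poly (R : realType) (n : nat) : {poly R} :=
  if n is m.+1 then J_poly R n - n%:R *: J_poly R m else J_poly R 0.

(* Main.v *)
Require Import Defs.
From mathcomp Require Import all_boot all_order all_algebra.
From mathcomp Require Import reals.

Import GRing.Theory.

Local Open Scope ring_scope.

(** Two facts about exponential generating functions carry the proof.

    Unfolding the Euler-Seidel recursion gives the binomial transform of the
    initial sequence ([euler_seidel_binomial]), and the binomial transform
    multiplies the exponential generating function by e^t
    ([fps_egf_euler_seidel]).  Hence each identity reduces to a closed form for
    the exponential generating function of K, J or L.

    For K, the series (1-t)^-2 e^(xt/(1-t)^2) is expanded along the exponential:
    its k-th term is x^k/k! times t^k (1-t)^-(2k+2), and the negative binomial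
    series ([fps_geometricX]) identifies the coefficient of t^n in the latter as
    C(n+k+1, n-k); this is [fps_egf_K].  Passing from u_n to u_n - n u_(n-1)
    multiplies the exponential generating function by 1 - t
    ([fps_egf_difference]), so the factor (1-t)^-2 of K loses one power of
    (1-t)^-1 for J and another one for L. *)

(** Induction on k: Pascal's rule merges the two shifted sums. *)
Lemma euler_seidel_binomial (V : zmodType) (a : nat -> V) (k n : nat) :
  euler_seidel a k n = \sum_(l < k.+1) a (n + l)%N *+ 'C(k, l).
Proof.
elim: k n => [|k IHk] n; first by rewrite big_ord1 addn0 bin0.
rewrite [LHS]/= !IHk [in RHS]big_ord_recl addn0 bin0.
under [X in _ = _ + X]eq_bigr => l _ do rewrite lift0 binS mulrnDr addnS -addSn.
rewrite big_split addrA; congr (_ + _).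
rewrite [LHS]big_ord_recl addn0 bin0; congr (_ + _).
rewrite big_ord_recr /= bin_small // mulr0n addr0.
by apply: eq_bigr => l _; rewrite /bump leq0n addnS.
Qed.

Lemma fps_coefM (A : comNzRingType) (f g : fps A) (n : nat) :
  fps_coef (f * g) n = \sum_(i < n.+1) fps_coef f i * fps_coef g (n - i).
Proof. by []. Qed.

Lemma fps_coefCM (A : comNzRingType) (c : A) (f : fps A) (n : nat) :
  fps_coef (fpsC c * f) n = c * fps_coef f n.
Proof.
rewrite fps_coefM big_ord_recl subn0 /= big1 ?addr0 // => i _.
by rewrite mul0r.
Qed.

Lemma fpsCX (A : comNzRingType) (c : A) (k : nat) :
  fpsC c ^+ k = fpsC (c ^+ k).
Proof.
elim: k => // k IHk; rewrite exprS IHk; apply/fpsP => n.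
by rewrite fps_coefCM /= exprS; case: eqP => // _; rewrite mulr0.
Qed.

Lemma fps_coefXM (A : comNzRingType) (f : fps A) (n : nat) :
  fps_coef (fpsX A * f) n = if n is m.+1 then fps_coef f m else 0.
Proof.
rewrite fps_coefM big_ord_recl /= mul0r add0r.
case: n => [|n]; first by rewrite big_ord0.
rewrite big_ord_recl /= mul1r subSS subn0 big1 ?addr0 // => i _.
by rewrite mul0r.
Qed.

Lemma fps_coefXnM (A : comNzRingType) (f : fps A) (k n : nat) :
  fps_coef (fpsX A ^+ k * f) n =
    if (k <= n)%N then fps_coef f (n - k) else 0.
Proof.
elim: k n => [|k IHk] n; first by rewrite mul1r subn0.
by rewrite exprS -mulrA fps_coefXM; case: n => // n; rewrite IHk.
Qed.

Lemma fps_coef_1subXM (A : comNzRingType) (f : fps A) (n : nat) :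
  fps_coef ((1 - fpsX A) * f) n =
    fps_coef f n - (if n is m.+1 then fps_coef f m else 0).
Proof.
rewrite mulrBl mul1r.
exact: (congr1 (fun c => fps_coef f n - c) (fps_coefXM _ f n)).
Qed.

Lemma fps_1subX_unit (A : comUnitRingType) : 1 - fpsX A \is a GRing.unit.
Proof.
change (fps_coef (1 - fpsX A) 0%N \is a GRing.unit).
by rewrite -[1 - _]mulr1 fps_coef_1subXM subr0 unitr1.
Qed.

(** The negative binomial series: multiplying its right-hand side by 1 - t
    lowers m by one, by Pascal's rule. *)
Lemma fps_geometricX (A : comUnitRingType) (m : nat) :
  (1 - fpsX A)^-1 ^+ m.+1 = Fps (fun n => 'C(n + m, m)%:R).
Proof.
elim: m => [|m IHm]; apply: (mulrI (fps_1subX_unit A)).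
  rewrite expr1 divrr ?fps_1subX_unit //; apply/fpsP => n.
  by rewrite fps_coef_1subXM; case: n => [|n] /=; rewrite !bin0 ?subr0 ?subrr.
rewrite exprS mulrA divrr ?fps_1subX_unit // mul1r IHm; apply/fpsP => n.
rewrite fps_coef_1subXM; case: n => [|n] /=; first by rewrite !add0n !binn subr0.
by rewrite addnS binS natrD addSnnS addrAC subrr add0r.
Qed.

(** A series may be distributed over the terms of an exponential because only
    the terms with k <= n reach the coefficient of t^n. *)
Lemma fps_coef_mul_exp (A : comUnitRingType) (f g : fps A) (n : nat) :
    fps_coef f 0%N = 0 ->
  fps_coef (g * fps_exp f) n =
    \sum_(k < n.+1) fps_coef (g * f ^+ k) n / (k`!)%:R.
Proof.
move=> f0; rewrite fps_coefM.
under [RHS]eq_bigr => k _ do rewrite fps_coefM mulr_suml.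
rewrite exchange_big /=; apply: eq_bigr => i _; rewrite mulr_sumr.
rewrite (big_ord_widen n.+1
  (fun k => fps_coef g i * (fps_coef (f ^+ k) (n - i) / (k`!)%:R)));
  last by rewrite ltnS leq_subr.
rewrite big_mkcond; apply: eq_bigr => k _; rewrite mulrA.
by case: ltnP => // lt_nik; rewrite fps_coef_exp_lt // mulr0 mul0r.
Qed.

Lemma fps_coef_expX (A : comUnitRingType) (n : nat) :
  fps_coef (fps_exp (fpsX A)) n = (n`!)%:R^-1.
Proof.
rewrite /= big_ord_recr /= big1 => [|k _].
  by rewrite -[_ ^+ n]mulr1 fps_coefXnM leqnn subnn mul1r add0r.
rewrite -[_ ^+ k]mulr1 fps_coefXnM ltnW //= subn_eq0 leqNgt ltn_ord.
by rewrite mul0r.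
Qed.

(** C(n, l)/n! = 1/(l! (n-l)!) turns the binomial transform into a Cauchy
    product with the coefficients 1/(n-l)! of e^t. *)
Lemma fps_egf_euler_seidel (A : comUnitRingType) (a : nat -> A) :
    (forall n, (n`!)%:R \is a @GRing.unit A) ->
  fps_egf (fun n => euler_seidel a n 0) = fps_exp (fpsX A) * fps_egf a.
Proof.
move=> factU; rewrite mulrC; apply/fpsP => n; rewrite fps_coefM [LHS]/=.
rewrite euler_seidel_binomial mulr_suml; apply: eq_bigr => l _.
rewrite fps_coef_expX /= add0n -[a l *+ _]mulr_natr -!mulrA; congr (_ * _).
have le_ln : (l <= n)%N by rewrite -ltnS.
rewrite -(bin_fact le_ln) !natrM.
have binU : 'C(n, l)%:R \is a @GRing.unit A.
  by have := factU n; rewrite -(bin_fact le_ln) natrM unitrM => /andP[].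
by rewrite invrM ?unitrM ?factU // mulrC divrK // invrM // mulrC.
Qed.

(** The factor n in n u_(n-1) reduces 1/n! to 1/(n-1)!, so the subtracted
    sequence contributes the generating function of u shifted by t. *)
Lemma fps_egf_difference (A : comUnitRingType) (u v : nat -> A) :
    (forall n, (n`!)%:R \is a @GRing.unit A) ->
    v 0%N = u 0%N ->
    (forall n, v n.+1 = u n.+1 - n.+1%:R * u n) ->
  fps_egf v = (1 - fpsX A) * fps_egf u.
Proof.
move=> factU v0 vS; apply/fpsP => n; rewrite fps_coef_1subXM.
case: n => [|n] /=; first by rewrite v0 subr0.
rewrite vS mulrBl; congr (_ - _).
have SnU : n.+1%:R \is a @GRing.unit A.
  by have := factU n.+1; rewrite factS natrM unitrM => /andP[].
by rewrite factS natrM invrM // mulrCA mulrAC divrr // mul1r mulrC.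
Qed.

Section Polynomials.

Variable R : realType.
Local Notation A := {poly R}.
Local Notation t := (fpsX A).
Local Notation x := (fpsC ('X : A)).

Lemma poly_fact_unit (n : nat) : (n`!)%:R \is a @GRing.unit A.
Proof.
by rewrite -polyC_natr rmorph_unit // unitfE Num.Theory.pnatr_eq0 -lt0n fact_gt0.
Qed.

Lemma fps_egf_K :
  fps_egf (K_poly R) = (1 - t)^-1 ^+ 2 * fps_exp (x * t / (1 - t) ^+ 2).
Proof.
apply/fpsP => n; rewrite fps_coef_mul_exp; last first.
  by rewrite -mulrA fps_coefCM fps_coefXM mulr0.
rewrite [LHS]/= /K_poly scaler_nat -[_ *+ n`!]mulr_natr mulrK ?poly_fact_unit //.
apply: eq_bigr => k _.
have -> : (1 - t)^-1 ^+ 2 * (x * t / (1 - t) ^+ 2) ^+ k =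
          fpsC ('X^k : A) * (t ^+ k * (1 - t)^-1 ^+ (2 * k).+2).
  rewrite -[((1 - t) ^+ 2)^-1]exprVn 2!exprMn -exprM fpsCX [LHS]mulrC.
  by rewrite -3!mulrA -exprD addn2.
rewrite fps_coefCM fps_coefXnM -ltnS ltn_ord fps_geometricX [fps_coef _ _]/=.
have le_kn : (k <= n)%N by rewrite -ltnS.
(* The exponent 2k+2 gives C((n-k)+(2k+1), 2k+1), the complementary form of
   C(n+k+1, n-k). *)
have -> : (n - k + (2 * k).+1 = n + k + 1)%N.
  by rewrite mul2n -addnn addnS addnA subnK // addn1.
have -> : 'C(n + k + 1, (2 * k).+1) = 'C(n + k + 1, n - k).
  rewrite -bin_sub; last by rewrite addn1 ltnS mul2n -addnn leq_add2r.
  by congr 'C(_, _); rewrite addn1 subSS mul2n -addnn subnDr.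
rewrite scaler_nat -[_ *: _ *+ _]mulr_natr -mul_polyC -polyCV polyC_natr.
by rewrite -[RHS]mulrA mulrC [LHS]mulrA mulrC.
Qed.

Lemma fps_egf_J :
  fps_egf (J_poly R) = (1 - t)^-1 * fps_exp (x * t / (1 - t) ^+ 2).
Proof.
rewrite (@fps_egf_difference _ (K_poly R)) ?fps_egf_K.
- by rewrite mulrA expr2 mulVKr ?fps_1subX_unit.
- exact: poly_fact_unit.
- by rewrite /K_poly big_ord1 subnn bin0 invr1 !scale1r.
- by move=> n; rewrite -[n.+1%:R in RHS]polyC_natr mul_polyC.
Qed.

Lemma fps_egf_L : fps_egf (L_poly R) = fps_exp (x * t / (1 - t) ^+ 2).
Proof.
rewrite (@fps_egf_difference _ (J_poly R)) ?fps_egf_J //.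
- by rewrite mulVKr ?fps_1subX_unit.
- exact: poly_fact_unit.
- by move=> n; rewrite -[n.+1%:R in RHS]polyC_natr mul_polyC.
Qed.

Lemma euler_seidel_poly (a u : nat -> A) :
    (forall n, a n = u n) ->
  (forall n, euler_seidel a n 0 = \sum_(l < n.+1) 'C(n, l)%:R *: u l) /\
  fps_egf (fun n => euler_seidel a n 0) = fps_exp t * fps_egf u.
Proof.
move=> au; split=> [n|].
  rewrite euler_seidel_binomial; apply: eq_bigr => l _.
  by rewrite scaler_nat au.
rewrite fps_egf_euler_seidel; last exact: poly_fact_unit.
by congr (_ * _); apply/fpsP => n; rewrite /= au.
Qed.

End Polynomials.

Theorem mainTheorem13 (R : realType) (a : nat -> {poly R}) :
  let t : fps {poly R} := fpsX {poly R} in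
  let x : fps {poly R} := fpsC ('X : {poly R}) in
  [/\ (forall n : nat, a n = K_poly R n) ->
        (forall n : nat, euler_seidel a n 0 =
           \sum_(l < n.+1) 'C(n, l)%:R *: K_poly R l) /\
        fps_egf (fun n : nat => euler_seidel a n 0) =
          fps_exp t * (1 / (1 - t) ^+ 2) * fps_exp (x * t / (1 - t) ^+ 2),
      (forall n : nat, a n = J_poly R n) ->
        (forall n : nat, euler_seidel a n 0 =
           \sum_(k < n.+1) 'C(n, k)%:R *: J_poly R k) /\
        fps_egf (fun n : nat => euler_seidel a n 0) =
          fps_exp t * (1 / (1 - t)) * fps_exp (x * t / (1 - t) ^+ 2)
    & (forall n : nat, a n = L_poly R n) ->
        (forall n : nat, euler_seidel a n 0 =
           \sum_(k < n.+1) 'C(n, k)%:R *: L_poly R k) /\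
        fps_egf (fun n : nat => euler_seidel a n 0) =
          fps_exp t * fps_exp (x * t / (1 - t) ^+ 2)].
Proof.
move=> t x; split=> /euler_seidel_poly[binE egfE]; split=> //; rewrite egfE.
- by rewrite fps_egf_K mulrA div1r exprVn.
- by rewrite fps_egf_J mulrA div1r.
- by rewrite fps_egf_L.
Qed.
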